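(* Let $0\le k_1\le k_2$ be integers with $k_2-k_1\le 1$, $\mathbf{k}=(k_1,k_2)$, and write $D_x=d/dx$. Then on $0\le x<1$ the function $\Xi_2^{[\mathbf{k}]}$ satisfies the third-order differential equation $$ \Bigl\{x^3(1+x^2)D_x^3+x^2\bigl((k_1-k_2+6)(x^2-1)+9\bigr)D_x^2-x\bigl((k_1+k_2)^2(x^2+1)+(k_2-k_1-\tfrac73)(3x^2-1)-\tfrac{10}{3}\bigr)D_x $$ $$ \qquad+x^2\bigl((k_1+k_2)^2-1\bigr)(k_2-k_1-1)+(k_1-k_2)(k_1+k_2)^2\Bigr\}\,\Xi_2^{[\mathbf{k}]}(x)=0 . $$
   Context: For non-negative integers $k_1,k_2$, $\mathbf{k}=(k_1,k_2)$ and $0\le x<1$ the rank-2 function is defined by $$ \Xi_2^{[\mathbf{k}]}(x):=\frac14\int_0^{\pi}\!\!\int_0^{\pi}\frac{\cos(k_1\theta_1)\cos(k_2\theta_2)}{\sqrt{1+x^2-x(\cos\theta_1+\cos\theta_2)}}\,d\theta_1\,d\theta_2 . $$ Derivatives at $x=0$ are understood as one-sided derivatives. *)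

(* Defs.v *)
(* Stdlib world (concrete real numbers R) with Coquelicot for the integrals. *)
From Stdlib Require Import Reals.
From Coquelicot Require Import Coquelicot.

Open Scope R_scope.

(* For 0 <= x < 1 the radicand is at least (1 - x)^2 > 0, so both integrands are
   continuous and the total operator [RInt] is the Riemann integral.  Only the
   values on [0, 1) are meaningful. *)
Definition Xi2 (k1 k2 : nat) (x : R) : R :=
  / 4 * RInt (fun t2 : R =>
          RInt (fun t1 : R =>
            (cos (INR k1 * t1) * cos (INR k2 * t2))
              / sqrt (1 + x ^ 2 - x * (cos t1 + cos t2)))
          0 PI)
        0 PI.

Definition unit_Ico (x : R) : Prop := 0 <= x < 1.

(* [D_in f f' D x] takes the limit of the difference quotient of f at x over
   points of D \ {x}: on D = [0, 1) this is the usual derivative for 0 < x and the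
   right derivative at x = 0.  Since every point of [0, 1) is a limit point of
   [0, 1), f' is uniquely determined there. *)
Definition is_deriv_Ico (f f' : R -> R) : Prop :=
  forall x : R, unit_Ico x -> D_in f f' unit_Ico x.

(* Main.v *)
Require Import Defs.
From Stdlib Require Import Reals Lra Lia ZArith.
From Coquelicot Require Import Coquelicot.
Open Scope R_scope.

(* Put [u = (cos t1 + cos t2) / 2].  The radicand is [1 + x^2 - 2 u x], so the
   integrand is the generating function of the Legendre polynomials [P_n(u)], and
   [Xi2 k1 k2] is a power series whose coefficients are the moments
   [c_n(i,j) = mean of P_n(u) cos(i t1) cos(j t2)].  Multiplication by [u] averages a
   moment over its four neighbours in Z^2, so Bonnet's recursion determines all
   moments algebraically.  Together with the moments of [P_n'] and integration by
   parts it yields contiguous relations between [c_n(k,k)] and [c_n(k,k+1)], from which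
   follow two-term recurrences in [n] (step 2), equivalent to the differential
   equation. *)

(** * Moments of Legendre polynomials and of their derivatives *)

Definition nbr_mean (f : Z -> Z -> R) (i j : Z) : R :=
  (f (i + 1)%Z j + f (i - 1)%Z j + f i (j + 1)%Z + f i (j - 1)%Z) / 4.

(* The term [Nat.pred 0 = 0] is harmless: its coefficient is [INR 0]. *)
Fixpoint legendre (n : nat) (u : R) : R :=
  match n with
  | O => 1
  | S m => ((2 * INR m + 1) * (u * legendre m u)
            - INR m * legendre (Nat.pred m) u) / (INR m + 1)
  end.

(* The mean over [0, PI]^2 of [P_n(u) cos(i t1) cos(j t2)]; see [legendre_moment]. *)
Fixpoint moment (n : nat) (i j : Z) : R :=
  match n with
  | O => if (Z.eqb i 0 && Z.eqb j 0)%bool then 1 else 0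
  | S m => ((2 * INR m + 1) * nbr_mean (moment m) i j
            - INR m * moment (Nat.pred m) i j) / (INR m + 1)
  end.

(* The same mean for [P_n'(u)], from the derivative of Bonnet's recursion. *)
Fixpoint dmoment (n : nat) (i j : Z) : R :=
  match n with
  | O => 0
  | S m => ((2 * INR m + 1) * (moment m i j + nbr_mean (dmoment m) i j)
            - INR m * dmoment (Nat.pred m) i j) / (INR m + 1)
  end.

Lemma legendre_rec n u :
  (INR n + 1) * legendre (S n) u
  = (2 * INR n + 1) * (u * legendre n u) - INR n * legendre (Nat.pred n) u.
Proof. pose proof (pos_INR n); simpl legendre; field; lra. Qed.

Lemma moment_rec n i j :
  (INR n + 1) * moment (S n) i j
  = (2 * INR n + 1) * nbr_mean (moment n) i j - INR n * moment (Nat.pred n) i j.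
Proof. pose proof (pos_INR n); simpl moment; field; lra. Qed.

Lemma dmoment_rec n i j :
  (INR n + 1) * dmoment (S n) i j
  = (2 * INR n + 1) * (moment n i j + nbr_mean (dmoment n) i j)
    - INR n * dmoment (Nat.pred n) i j.
Proof. pose proof (pos_INR n); simpl dmoment; field; lra. Qed.

(** Induction matched to three-term recursions written with [Nat.pred]: the step at [n = 0] needs no
    separate treatment. *)
Lemma nat_ind_pred (P : nat -> Prop) :
  P O -> (forall n, P n -> P (Nat.pred n) -> P (S n)) -> forall n, P n.
Proof.
intros H0 HS n.
assert (H : P n /\ P (Nat.pred n)); [|tauto].
induction n as [|n [IH1 IH2]]; simpl; auto.
Qed.

Lemma Rmult_INR_succ_inj n a b : (INR n + 1) * a = (INR n + 1) * b -> a = b.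
Proof. pose proof (pos_INR n); intros; apply Rmult_eq_reg_l with (INR n + 1); lra. Qed.

Lemma moment_sym n i j : moment n i j = moment n j i.
Proof.
revert i j; induction n as [|n IH IH'] using nat_ind_pred; intros i j.
- simpl; now rewrite Bool.andb_comm.
- apply (Rmult_INR_succ_inj n); rewrite !moment_rec, (IH' i j).
  unfold nbr_mean.
  rewrite (IH (i + 1)%Z j), (IH (i - 1)%Z j), (IH i (j + 1)%Z), (IH i (j - 1)%Z).
  lra.
Qed.

Lemma dmoment_sym n i j : dmoment n i j = dmoment n j i.
Proof.
revert i j; induction n as [|n IH IH'] using nat_ind_pred; intros i j.
- reflexivity.
- apply (Rmult_INR_succ_inj n); rewrite !dmoment_rec, (IH' i j), (moment_sym n i j).
  unfold nbr_mean.
  rewrite (IH (i + 1)%Z j), (IH (i - 1)%Z j), (IH i (j + 1)%Z), (IH i (j - 1)%Z).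
  lra.
Qed.

(* Integration by parts in [t1], as [d/dt1 P_n(u) = - sin t1 / 2 * P_n'(u)]; proved
   algebraically from the recursions. *)
Lemma moment_by_parts n i j :
  4 * IZR i * moment n i j = dmoment n (i - 1)%Z j - dmoment n (i + 1)%Z j.
Proof.
revert i j; induction n as [|n IH IH'] using nat_ind_pred; intros i j.
- simpl. destruct (Z.eqb_spec i 0); simpl.
  + subst; lra.
  + lra.
- apply (Rmult_INR_succ_inj n).
  rewrite Rmult_minus_distr_l, !dmoment_rec.
  replace ((INR n + 1) * (4 * IZR i * moment (S n) i j))
    with (4 * IZR i * ((INR n + 1) * moment (S n) i j)) by ring.
  rewrite moment_rec.
  pose proof (IH' i j) as H0.
  pose proof (IH (i + 1)%Z j) as H1. pose proof (IH (i - 1)%Z j) as H2.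
  pose proof (IH i (j + 1)%Z) as H3. pose proof (IH i (j - 1)%Z) as H4.
  unfold nbr_mean.
  rewrite plus_IZR in H1; rewrite minus_IZR in H2.
  replace (i - 1 + 1)%Z with i in * by lia.
  replace (i + 1 - 1)%Z with i in * by lia.
  nra.
Qed.

(* [P_{n+1}' - u P_n' = (n+1) P_n] and [u P_{n+1}' - P_n' = (n+1) P_{n+1}]. *)
Lemma dmoment_contiguous n i j :
  dmoment (S n) i j - nbr_mean (dmoment n) i j = (INR n + 1) * moment n i j
  /\ nbr_mean (dmoment (S n)) i j - dmoment n i j
     = (INR n + 1) * moment (S n) i j.
Proof.
revert i j; induction n as [|n IH]; intros i j.
- split.
  + pose proof (dmoment_rec 0 i j) as H; simpl in *; unfold nbr_mean in *; lra.
  + pose proof (moment_rec 0 i j) as H.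
    unfold nbr_mean; simpl in *; unfold nbr_mean in *; simpl; lra.
(* The first identity at [S n] comes from [dmoment_rec] and the second identity at [n]. Averaging it
   over the neighbours, with both identities at [n] and Bonnet's recursion, then gives the second at
   [S n]. *)
- assert (up : forall i j, dmoment (S (S n)) i j - nbr_mean (dmoment (S n)) i j
                 = (INR (S n) + 1) * moment (S n) i j).
  { intros i' j'; apply (Rmult_INR_succ_inj (S n)).
    rewrite Rmult_minus_distr_l, dmoment_rec; simpl Nat.pred.
    destruct (IH i' j') as [_ H]; rewrite S_INR; nra. }
  split; [apply up|].
  pose proof (up (i + 1)%Z j) as U1. pose proof (up (i - 1)%Z j) as U2.
  pose proof (up i (j + 1)%Z) as U3. pose proof (up i (j - 1)%Z) as U4.
  destruct (IH (i + 1)%Z j) as [_ V1]. destruct (IH (i - 1)%Z j) as [_ V2].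
  destruct (IH i (j + 1)%Z) as [_ V3]. destruct (IH i (j - 1)%Z) as [_ V4].
  destruct (IH i j) as [W _].
  rewrite moment_rec, S_INR; simpl Nat.pred.
  rewrite S_INR in U1, U2, U3, U4.
  unfold nbr_mean; unfold nbr_mean in W.
  lra.
Qed.

(** * Contiguous relations on and next to the diagonal *)

Lemma nbr_mean_diag f k : (forall i j, f i j = f j i) ->
  nbr_mean f k k = (f (k - 1)%Z k + f k (k + 1)%Z) / 2.
Proof.
intros sym; unfold nbr_mean.
rewrite (sym (k + 1)%Z k), (sym k (k - 1)%Z); lra.
Qed.

Lemma nbr_mean_near_diag (f : Z -> Z -> R) k :
  nbr_mean f k (k + 1)
  = (f k k + f (k + 1)%Z (k + 1)%Z + f (k - 1)%Z (k + 1)%Z + f k (k + 2)%Z) / 4.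
Proof.
unfold nbr_mean.
replace (k + 1 + 1)%Z with (k + 2)%Z by lia.
replace (k + 1 - 1)%Z with k by lia.
lra.
Qed.

Lemma moment_0_diag k : IZR k * moment 0 k k = 0.
Proof. simpl; destruct (Z.eqb_spec k 0); simpl; subst; lra. Qed.

Lemma moment_0_near_diag k : moment 0 k (k + 1) = 0.
Proof.
simpl; destruct (Z.eqb_spec k 0), (Z.eqb_spec (k + 1) 0); simpl; trivial; lia.
Qed.

Lemma moment_diag_sum n k :
  (INR n + 1) * moment (S n) k k + INR n * moment (Nat.pred n) k k
  = (2 * INR n + 1) / 2 * (moment n k (k + 1) + moment n (k - 1) k).
Proof.
rewrite moment_rec, nbr_mean_diag by apply moment_sym; lra.
Qed.

Lemma moment_1_diag k : moment 1 k k = 0.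
Proof.
pose proof (moment_diag_sum 0 k) as H; simpl INR in H.
pose proof (moment_0_near_diag k) as H1; pose proof (moment_0_near_diag (k - 1)) as H2.
replace (k - 1 + 1)%Z with k in H2 by lia.
lra.
Qed.

(** Integration by parts at degrees [n + 2] and [n], combined with
    [P_{n+2}' - P_n' = (2n+3) P_{n+1}]. *)
Lemma moment_diag_diff n k :
  2 * IZR k * (moment (S (S n)) k k - moment n k k)
  = (2 * INR n + 3) / 2 * (moment (S n) (k - 1) k - moment (S n) k (k + 1)).
Proof.
assert (shift : forall i j, dmoment (S (S n)) i j - dmoment n i j
                  = (2 * INR n + 3) * moment (S n) i j).
{ intros i j; destruct (dmoment_contiguous (S n) i j) as [H _].
  destruct (dmoment_contiguous n i j) as [_ H']; rewrite S_INR in H; lra. }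
pose proof (moment_by_parts (S (S n)) k k) as H1.
pose proof (moment_by_parts n k k) as H2.
pose proof (shift (k - 1)%Z k) as H3. pose proof (shift (k + 1)%Z k) as H4.
rewrite (moment_sym (S n) (k + 1)) in H4.
lra.
Qed.

(** Subtracting [moment_diag_diff] from [moment_diag_sum] eliminates the moment at [(k-1, k)]. *)
Lemma moment_upper n k :
  (INR n + 2 - 2 * IZR k) * moment (S (S n)) k k
  + (INR n + 1 + 2 * IZR k) * moment n k k
  = (2 * INR n + 3) * moment (S n) k (k + 1).
Proof.
pose proof (moment_diag_sum (S n) k) as H1; pose proof (moment_diag_diff n k) as H2.
rewrite S_INR in H1; simpl Nat.pred in H1; lra.
Qed.

(** Here the two relations are taken at [k + 1] and added, which eliminates the moment at
    [(k+1, k+2)]. *)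
Lemma moment_lower n k :
  (INR n + 4 + 2 * IZR k) * moment (S (S n)) (k + 1) (k + 1)
  + (INR n - 1 - 2 * IZR k) * moment n (k + 1) (k + 1)
  = (2 * INR n + 3) * moment (S n) k (k + 1).
Proof.
pose proof (moment_diag_sum (S n) (k + 1)) as H1.
pose proof (moment_diag_diff n (k + 1)) as H2.
rewrite S_INR in H1; rewrite plus_IZR in H2; simpl Nat.pred in H1.
replace (k + 1 - 1)%Z with k in * by lia.
lra.
Qed.

(** Integration by parts expresses every derivative moment that occurs through those at [(k, k)],
    [(k+1, k+1)] and [(k, k+1)]. Both sides then equal [dmoment (S n) k k + dmoment (S n) (k+1)
    (k+1) - 2 * dmoment n k (k+1)]. *)
Lemma moment_raise n k :
  (INR n + 1 + 2 * IZR k) * moment n k k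
  + (INR n - 1 - 2 * IZR k) * moment n (k + 1) (k + 1)
  = 2 * (INR n + 2) * moment (S n) k (k + 1).
Proof.
destruct (dmoment_contiguous n k k) as [A1 _].
destruct (dmoment_contiguous n (k + 1) (k + 1)) as [A2 _].
destruct (dmoment_contiguous n k (k + 1)) as [_ A3].
rewrite nbr_mean_diag in A1, A2 by apply dmoment_sym.
rewrite nbr_mean_near_diag in A3.
pose proof (moment_by_parts n k k) as B1.
pose proof (moment_by_parts n (k + 1) (k + 1)) as B2.
pose proof (moment_by_parts (S n) k (k + 1)) as B3.
pose proof (moment_by_parts (S n) (k + 1) k) as B4.
rewrite plus_IZR in B2, B4.
replace (k + 1 - 1)%Z with k in * by lia.
replace (k + 1 + 1)%Z with (k + 2)%Z in * by lia.
rewrite (dmoment_sym n (k + 1) k) in B1.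
rewrite (dmoment_sym n (k + 2)) in B2.
rewrite (dmoment_sym (S n) (k + 2)), (moment_sym _ (k + 1)) in B4.
nra.
Qed.

(** In positive degree this is [moment_upper] plus [moment_lower] minus [moment_raise]. *)
Lemma moment_descend n k :
  (INR n + 1 - 2 * IZR k) * moment (S n) k k
  + (INR n + 3 + 2 * IZR k) * moment (S n) (k + 1) (k + 1)
  = 2 * INR n * moment n k (k + 1).
Proof.
destruct n as [|n].
- rewrite !moment_1_diag; simpl; lra.
- pose proof (moment_upper n k) as H1; pose proof (moment_lower n k) as H2.
  pose proof (moment_raise n k) as H3.
  rewrite S_INR; lra.
Qed.

(* The expression at [n + 2] equals the one at [n], by [moment_upper], [moment_lower] and [moment_raise]. *)
Lemma moment_diag_shift n k :
  (INR n - 2 * IZR k - 1) * (INR n + 2 * IZR k + 2) * moment n (k + 1) (k + 1)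
  + (INR n + 2 * IZR k + 1) * (INR n - 2 * IZR k) * moment n k k = 0.
Proof.
(* Two consecutive degrees are carried along, since the step goes from [n] to [n + 2]. *)
assert (H : forall m, m = n \/ m = S n ->
  (INR m - 2 * IZR k - 1) * (INR m + 2 * IZR k + 2) * moment m (k + 1) (k + 1)
  + (INR m + 2 * IZR k + 1) * (INR m - 2 * IZR k) * moment m k k = 0);
  [|now apply H; left].
induction n as [|n IH]; intros m [->| ->].
- pose proof (moment_0_diag k) as H1; pose proof (moment_0_diag (k + 1)) as H2.
  rewrite plus_IZR in H2; simpl INR.
  apply (f_equal (Rmult (2 * IZR k + 1))) in H1, H2; lra.
- rewrite !moment_1_diag; lra.
- apply IH; now right.
- pose proof (IH n (or_introl eq_refl)) as H0.
  pose proof (moment_upper n k) as H1; pose proof (moment_lower n k) as H2.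
  pose proof (moment_raise n k) as H3.
  apply (f_equal (Rmult (INR n + 1 - 2 * IZR k))) in H2.
  (* These multipliers produce the coefficients of the claim in degree [n + 2]; the terms in
     [moment (S n) k (k + 1)] cancel. *)
  apply (f_equal (Rmult (INR n + 3 + 2 * IZR k))) in H1.
  apply (f_equal (Rmult (2 * INR n + 3))) in H3.
  rewrite !S_INR; lra.
Qed.

(** * Two-term recurrences in the degree *)

(** The difference of [moment_upper] and [moment_lower] contains diagonal moments only;
    [moment_diag_shift] at [n] and [n + 2] turns those at [k + 1] into those at [k]. *)
Lemma moment_diag_step n k :
  (INR n + 2) * ((INR n + 2) ^ 2 - 4 * IZR k ^ 2) * moment (S (S n)) k k
  + (INR n + 1) * ((INR n + 1) ^ 2 - 4 * IZR k ^ 2) * moment n k k = 0.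
Proof.
pose proof (moment_upper n k) as H1; pose proof (moment_lower n k) as H2.
pose proof (moment_diag_shift n k) as H3.
pose proof (moment_diag_shift (S (S n)) k) as H4.
rewrite !S_INR in H4.
apply (f_equal (Rmult ((INR n + 1 - 2 * IZR k) * (INR n + 2 + 2 * IZR k)))) in H1, H2.
apply (f_equal (Rmult (INR n + 2 + 2 * IZR k))) in H4.
apply (f_equal (Rmult (INR n + 1 - 2 * IZR k))) in H3.
lra.
Qed.

(** [moment_raise] and [moment_descend] express the near-diagonal moments of degrees [n + 2] and [n]
    through the same two diagonal moments of degree [n + 1]. The combination taken is [2n + 3] times
    [moment_diag_shift], hence zero. *)
Lemma moment_near_diag_step n k :
  (INR n + 3) * ((INR n + 2) ^ 2 - (2 * IZR k + 1) ^ 2) * moment (S (S n)) k (k + 1)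
  + INR n * ((INR n + 1) ^ 2 - (2 * IZR k + 1) ^ 2) * moment n k (k + 1) = 0.
Proof.
pose proof (moment_raise (S n) k) as H1; pose proof (moment_descend n k) as H2.
pose proof (moment_diag_shift (S n) k) as H3.
rewrite S_INR in H1, H3.
apply (f_equal (Rmult ((INR n + 1 - 2 * IZR k) * (INR n + 3 + 2 * IZR k)))) in H1.
apply (f_equal (Rmult ((INR n - 2 * IZR k) * (INR n + 2 + 2 * IZR k)))) in H2.
apply (f_equal (Rmult (2 * INR n + 3))) in H3.
lra.
Qed.

(** The factor is [-4 k (k + 1)], which annihilates both degree-zero moments in [moment_raise]. This
    supplies the initial condition of the recurrence in odd degrees. *)
Lemma moment_1_near_diag k :
  (1 - (2 * IZR k + 1) ^ 2) * moment 1 k (k + 1) = 0.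
Proof.
pose proof (moment_raise 0 k) as H.
pose proof (moment_0_diag k) as H1; pose proof (moment_0_diag (k + 1)) as H2.
rewrite plus_IZR in H2; simpl INR in H.
apply (f_equal (Rmult (IZR k * (IZR k + 1)))) in H.
apply (f_equal (Rmult ((IZR k + 1) * (1 + 2 * IZR k)))) in H1.
apply (f_equal (Rmult (IZR k * (-1 - 2 * IZR k)))) in H2.
lra.
Qed.

(** * Bound and generating function of the Legendre polynomials, with power series tools *)

(** [P_{m+1}(u)] is one coordinate of a point of the unit disc. The other coordinate, the witness
    [v] below, is [s * P_{m+1}'(u) / (m+1)]. *)
Lemma legendre_bound n u : Rabs u <= 1 -> Rabs (legendre n u) <= 1.
Proof.
intros hu%Rabs_le_between.
pose (s := sqrt (1 - u ^ 2)).
assert (hs : s * s = 1 - u ^ 2) by (apply sqrt_sqrt; nra).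
(* With [r = (m + 1) / (m + 2)], the next pair is the rotation by [(u, s)] of
   [(P_{m+1}, r v)], so its norm does not increase. *)
assert (H : forall m, exists v,
  u * legendre (S m) u + s * v = legendre m u /\ legendre (S m) u ^ 2 + v ^ 2 <= 1).
{ intros m; induction m as [|m [v [IH1 IH2]]].
  - exists s; pose proof (legendre_rec 0 u) as H; simpl INR in H.
    replace (legendre 1 u) with u by (simpl in *; lra).
    simpl legendre; nra.
  - pose proof (legendre_rec (S m) u) as H; rewrite S_INR in H; simpl Nat.pred in H.
    pose proof (pos_INR m) as hm.
    set (r := (INR m + 1) / (INR m + 2)).
    assert (hr : 0 <= r <= 1).
    { unfold r; split; [apply Rdiv_le_0_compat|apply Rle_div_l]; lra. }
    assert (E : legendre (S (S m)) u = u * legendre (S m) u - r * (s * v)).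
    { apply (Rmult_eq_reg_l (INR m + 2)); [|lra].
      replace (s * v) with (legendre m u - u * legendre (S m) u) by lra.
      transitivity ((INR m + 2) * (u * legendre (S m) u)
        - (INR m + 2) * r * (legendre m u - u * legendre (S m) u)); [|ring].
      replace ((INR m + 2) * r) with (INR m + 1) by (unfold r; field; lra).
      lra. }
    exists (s * legendre (S m) u + u * (r * v)); rewrite E; split.
    + replace (legendre (S m) u) with ((u ^ 2 + s * s) * legendre (S m) u) at 3
        by (rewrite hs; ring).
      ring.
    + replace (_ + _) with
        ((u ^ 2 + s * s) * (legendre (S m) u ^ 2 + r ^ 2 * v ^ 2)) by ring.
      rewrite hs.
      assert (r ^ 2 <= 1) by nra.
      pose proof (pow2_ge_0 v); nra. }
apply Rabs_le; destruct n as [|n]; [simpl; lra|].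
destruct (H n) as [v [_ Hv]]; nra.
Qed.

(** A radius below the midpoint of [x] and [1] would contradict convergence there, as the terms do
    not tend to zero outside the disc. *)
Lemma CV_radius_ge_1 (a : nat -> R) :
  (forall x, 0 <= x < 1 -> ex_pseries a x) ->
  forall x, 0 <= x < 1 -> Rbar_lt (Rabs x) (CV_radius a).
Proof.
intros H x hx; apply Rbar_lt_le_trans with ((x + 1) / 2).
- rewrite Rabs_pos_eq by lra; simpl; lra.
- apply Rbar_not_lt_le; intros h.
  apply (CV_disk_outside a ((x + 1) / 2)).
  + rewrite Rabs_pos_eq by lra; exact h.
  + apply ex_series_lim_0.
    destruct (H ((x + 1) / 2)) as [l Hl]; [lra|].
    exists l; now apply is_pseries_R.
Qed.

Lemma is_pseries_mul_x (a : nat -> R) (x l : R) :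
  is_pseries a x l -> is_pseries (PS_incr_1 a) x (x * l).
Proof. exact (is_pseries_incr_1 a x l). Qed.

Lemma is_pseries_mul_const (a : nat -> R) (c x l : R) :
  is_pseries a x l -> is_pseries (fun n => c * a n) x (c * l).
Proof. exact (is_pseries_scal c a x l (Rmult_comm _ _)). Qed.

Lemma is_pseries_add (a b : nat -> R) (x l m : R) :
  is_pseries a x l -> is_pseries b x m -> is_pseries (fun n => a n + b n) x (l + m).
Proof. exact (is_pseries_plus a b x l m). Qed.

Lemma is_pseries_zero (a : nat -> R) (x l : R) :
  (forall n, a n = 0) -> is_pseries a x l -> l = 0.
Proof.
intros ha H; rewrite <- (is_pseries_unique _ _ _ H).
now rewrite (PSeries_ext _ (fun _ => 0)), PSeries_const_0.
Qed.

Lemma legendre_ex_pseries u x : Rabs u <= 1 -> 0 <= x < 1 ->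
  ex_pseries (fun n => legendre n u) x.
Proof.
intros hu hx.
apply CV_disk_correct; unfold CV_disk.
apply (ex_series_le (fun n => Rabs (legendre n u * x ^ n)) (fun n => x ^ n)).
- intros n; change (Rabs (Rabs (legendre n u * x ^ n)) <= x ^ n).
  rewrite Rabs_Rabsolu, Rabs_mult, (Rabs_pos_eq (x ^ n)) by (apply pow_le; lra).
  pose proof (legendre_bound n u hu); pose proof (pow_le x n (proj1 hx)); nra.
- exists (/ (1 - x)); apply is_series_geom; rewrite Rabs_pos_eq; lra.
Qed.

Lemma radicand_pos u x : Rabs u <= 1 -> 0 <= x < 1 -> 0 < 1 + x ^ 2 - 2 * u * x.
Proof. intros hu%Rabs_le_between hx; nra. Qed.

(** Comparing coefficients of [x^n] gives exactly Bonnet's recursion. *)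
Lemma legendre_generating_ode u x : Rabs u <= 1 -> 0 <= x < 1 ->
  (1 + x ^ 2 - 2 * u * x) * PSeries (PS_derive (fun n => legendre n u)) x
  = (u - x) * PSeries (fun n => legendre n u) x.
Proof.
intros hu hx; set (a := fun n => legendre n u).
assert (hr : Rbar_lt (Rabs x) (CV_radius a)).
{ apply CV_radius_ge_1; trivial; intros; now apply legendre_ex_pseries. }
assert (A : is_pseries a x (PSeries a x)) by now apply PSeries_correct, CV_radius_inside.
assert (B : is_pseries (PS_derive a) x (PSeries (PS_derive a) x)).
{ apply PSeries_correct, CV_radius_inside; now rewrite CV_radius_derive. }
pose proof (is_pseries_mul_x _ _ _ B) as B1.
pose proof (is_pseries_add _ _ _ _ _
  (is_pseries_add _ _ _ _ _ B
    (is_pseries_add _ _ _ _ _ (is_pseries_mul_const _ (- (2 * u)) _ _ B1)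
       (is_pseries_mul_x _ _ _ B1)))
  (is_pseries_add _ _ _ _ _ (is_pseries_mul_const _ (- u) _ _ A)
     (is_pseries_mul_x _ _ _ A))) as H.
apply is_pseries_zero in H; [lra|].
intros n; unfold PS_incr_1, PS_derive, a; change zero with 0.
destruct n as [|[|n]];
  match goal with |- context [legendre (S ?m) u] =>
    pose proof (legendre_rec m u) as E; simpl Nat.pred in E end;
  cbv beta iota; rewrite ?S_INR in *; simpl INR in *; lra.
Qed.

(* By [legendre_generating_ode], [PSeries * sqrt radicand] has derivative zero. *)
Lemma legendre_generating u x : Rabs u <= 1 -> 0 <= x < 1 ->
  is_series (fun n => legendre n u * x ^ n) (/ sqrt (1 + x ^ 2 - 2 * u * x)).
Proof.
intros hu hx; set (a := fun n => legendre n u).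
pose (g t := PSeries a t * sqrt (1 + t ^ 2 - 2 * u * t)).
assert (hg : forall t, 0 <= t < 1 -> is_derive g t 0).
{ intros t ht; pose proof (radicand_pos u t hu ht) as hR.
  pose proof (sqrt_lt_R0 _ hR) as hs.
  assert (hd : is_derive (fun t => sqrt (1 + t ^ 2 - 2 * u * t)) t
                 ((t - u) / sqrt (1 + t ^ 2 - 2 * u * t))).
  { auto_derive; [lra|].
    replace (1 + t * (t * 1) + - (2 * u * t)) with (1 + t ^ 2 - 2 * u * t) by ring.
    field; lra. }
  assert (hS : is_derive (PSeries a) t (PSeries (PS_derive a) t)).
  { apply is_derive_PSeries, CV_radius_ge_1; trivial.
    intros; now apply legendre_ex_pseries. }
  pose proof (is_derive_mult _ _ t _ _ hS hd Rmult_comm) as H.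
  replace 0 with (plus (mult (PSeries (PS_derive a) t) (sqrt (1 + t ^ 2 - 2 * u * t)))
    (mult (PSeries a t) ((t - u) / sqrt (1 + t ^ 2 - 2 * u * t)))); [exact H|].
  pose proof (legendre_generating_ode u t hu ht) as E; fold a in E.
  set (w := sqrt (1 + t ^ 2 - 2 * u * t)) in *.
  assert (hw : w * w = 1 + t ^ 2 - 2 * u * t) by (apply sqrt_sqrt; lra).
  change (PSeries (PS_derive a) t * w + PSeries a t * ((t - u) / w) = 0).
  transitivity ((PSeries (PS_derive a) t * (w * w) + PSeries a t * (t - u)) / w);
    [field; lra|].
  rewrite hw; replace (_ + _) with 0 by lra; unfold Rdiv; ring. }
assert (E : g 0 = g x).
{ destruct (Req_dec x 0) as [->|hx0]; [reflexivity|].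
  apply eq_is_derive; [|lra]; intros t ht; apply hg; lra. }
unfold g in E; rewrite PSeries_0 in E.
replace (1 + 0 ^ 2 - 2 * u * 0) with 1 in E by ring; rewrite sqrt_1 in E.
pose proof (sqrt_lt_R0 _ (radicand_pos u x hu hx)) as hs.
replace (/ sqrt (1 + x ^ 2 - 2 * u * x)) with (PSeries a x).
- apply (is_pseries_R a), PSeries_correct; now apply legendre_ex_pseries.
- apply (Rmult_eq_reg_r (sqrt (1 + x ^ 2 - 2 * u * x))); [|lra].
  rewrite <- E, Rinv_l by lra; unfold a; simpl; lra.
Qed.

(** The terms [b n + a n] and [b n - a n] are nonnegative, so their partial sums stay below the
    limits. For Legendre series this gives an error bound independent of the angles. *)
Lemma series_tail_bound (a b : nat -> R) (la lb : R) :
  (forall n, Rabs (a n) <= b n) -> is_series a la -> is_series b lb ->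
  forall n, Rabs (sum_n a n - la) <= lb - sum_n b n.
Proof.
intros hab ha hb n.
assert (H : forall (c : nat -> R) (lc : R), is_series c lc -> (forall n, - b n <= c n) ->
                    sum_n b n + sum_n c n <= lb + lc).
{ intros c lc hc hbc.
  apply (is_lim_seq_incr_compare (fun n => sum_n b n + sum_n c n)).
  - now apply (is_lim_seq_plus' _ _ lb lc).
  - intros m; rewrite !sum_Sn; unfold plus; simpl; specialize (hbc (S m)); lra. }
pose proof (H a la ha) as H1; pose proof (H (fun n => - a n) (- la)) as H2.
assert (hs : sum_n (fun n => - a n) n = - sum_n a n).
{ clear; induction n as [|n IH]; [now rewrite !sum_O|].
  rewrite !sum_Sn, IH; unfold plus; simpl; ring. }
rewrite hs in H2.
apply Rabs_le; split.
- enough (sum_n b n + - sum_n a n <= lb + - la) by lra.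
  apply H2; [now apply (is_series_opp a)|].
  intros m; specialize (hab m); apply Rabs_le_between in hab; lra.
- enough (sum_n b n + sum_n a n <= lb + la) by lra.
  apply H1; intros m; specialize (hab m); apply Rabs_le_between in hab; lra.
Qed.

(** * Iterated integrals and the moments as integrals *)

(** The order of integration is that of [Xi2]. Existence of every inner integral allows linearity to
    be used under the outer one. *)
Definition is_RInt2 (f : R -> R -> R) (l : R) : Prop :=
  (forall t2, ex_RInt (fun t1 => f t1 t2) 0 PI)
  /\ is_RInt (fun t2 => RInt (fun t1 => f t1 t2) 0 PI) 0 PI l.

Lemma is_RInt2_ext f g l :
  (forall s t, f s t = g s t) -> is_RInt2 f l -> is_RInt2 g l.
Proof.
intros E [H1 H2]; split.
- intros t; eapply ex_RInt_ext; [|apply (H1 t)]; intros; apply E.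
- eapply is_RInt_ext; [|apply H2]; intros; apply RInt_ext; intros; apply E.
Qed.

Lemma is_RInt2_plus f g lf lg :
  is_RInt2 f lf -> is_RInt2 g lg -> is_RInt2 (fun s t => f s t + g s t) (lf + lg).
Proof.
intros [F1 F2] [G1 G2]; split.
- intros t; now apply (ex_RInt_plus (V := R_NormedModule)).
- eapply is_RInt_ext; [|apply (is_RInt_plus _ _ _ _ _ _ F2 G2)].
  intros t _; symmetry; now apply (RInt_plus (V := R_CompleteNormedModule)).
Qed.

Lemma is_RInt2_scal f k l :
  is_RInt2 f l -> is_RInt2 (fun s t => k * f s t) (k * l).
Proof.
intros [F1 F2]; split.
- intros t; now apply (ex_RInt_scal (V := R_NormedModule)).
- eapply is_RInt_ext; [|apply (is_RInt_scal _ _ _ k _ F2)].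
  intros t _; symmetry; now apply (RInt_scal (V := R_CompleteNormedModule)).
Qed.

Lemma is_RInt_cos (i : Z) :
  is_RInt (fun t => cos (IZR i * t)) 0 PI (if Z.eqb i 0 then PI else 0).
Proof.
destruct (Z.eqb_spec i 0) as [->|hi].
- apply is_RInt_ext with (fun _ => 1).
  + intros t _; now rewrite Rmult_0_l, cos_0.
  + pose proof (is_RInt_const 0 PI 1) as H.
    unfold scal in H; simpl in H; unfold mult in H; simpl in H.
    now rewrite Rminus_0_r, Rmult_1_r in H.
- assert (hi' : IZR i <> 0) by now apply not_0_IZR.
  pose proof (is_RInt_derive (fun t => sin (IZR i * t) / IZR i)
    (fun t => cos (IZR i * t)) 0 PI) as H.
  cbv beta in H; rewrite Rmult_0_r, sin_0, (sin_eq_0_1 (IZR i * PI)) in H by now exists i.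
  unfold minus, plus, opp in H; simpl in H.
  replace 0 with (0 / IZR i + - (0 / IZR i)) at 2 by ring.
  apply H.
  + intros t _; auto_derive; [trivial|field; trivial].
  + intros t _; apply (ex_derive_continuous (V := R_NormedModule)).
    auto_derive; trivial.
Qed.

Lemma cos_mul_cos (i : Z) t :
  cos t * cos (IZR i * t) = (cos (IZR (i + 1) * t) + cos (IZR (i - 1) * t)) / 2.
Proof.
rewrite plus_IZR, minus_IZR.
replace ((IZR i + 1) * t) with (IZR i * t + t) by ring.
replace ((IZR i - 1) * t) with (IZR i * t - t) by ring.
rewrite cos_plus, cos_minus; field.
Qed.

Definition harmonic (i j : Z) (s t : R) : R := cos (IZR i * s) * cos (IZR j * t).

Lemma legendre_moment n i j :
  is_RInt2 (fun s t => legendre n ((cos s + cos t) / 2) * harmonic i j s t)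
    (PI ^ 2 * moment n i j).
Proof.
revert i j; induction n as [|n IH IH'] using nat_ind_pred; intros i j.
- split.
  + intros t; eexists.
    eapply is_RInt_ext; [|apply (is_RInt_scal _ _ _ (cos (IZR j * t)) _ (is_RInt_cos i))].
    intros s _; unfold harmonic, scal; simpl; unfold mult; simpl; ring.
  + eapply is_RInt_ext.
    * intros t _; symmetry; apply is_RInt_unique.
      eapply is_RInt_ext; [|apply (is_RInt_scal _ _ _ (cos (IZR j * t)) _ (is_RInt_cos i))].
      intros s _; unfold harmonic, scal; simpl; unfold mult; simpl; ring.
    * pose proof (is_RInt_scal _ _ _ (if Z.eqb i 0 then PI else 0) _ (is_RInt_cos j)) as H.
      replace (PI ^ 2 * moment 0 i j) with
        (scal (if Z.eqb i 0 then PI else 0) (if Z.eqb j 0 then PI else 0)).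
      -- eapply is_RInt_ext; [|exact H].
         intros t _; unfold scal; simpl; unfold mult; simpl; ring.
      -- unfold scal; simpl; unfold mult; simpl.
         destruct (Z.eqb i 0), (Z.eqb j 0); simpl; ring.
- pose proof (pos_INR n) as hn.
  pose proof (is_RInt2_scal _ ((2 * INR n + 1) / (INR n + 1) / 4) _
    (is_RInt2_plus _ _ _ _ (is_RInt2_plus _ _ _ _ (IH (i + 1)%Z j) (IH (i - 1)%Z j))
       (is_RInt2_plus _ _ _ _ (IH i (j + 1)%Z) (IH i (j - 1)%Z)))) as H1.
  pose proof (is_RInt2_scal _ (- INR n / (INR n + 1)) _ (IH' i j)) as H2.
  pose proof (is_RInt2_plus _ _ _ _ H1 H2) as H.
  replace (PI ^ 2 * moment (S n) i j) with
    (((2 * INR n + 1) / (INR n + 1) / 4) *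
      (PI ^ 2 * moment n (i + 1) j + PI ^ 2 * moment n (i - 1) j
       + (PI ^ 2 * moment n i (j + 1) + PI ^ 2 * moment n i (j - 1)))
     + - INR n / (INR n + 1) * (PI ^ 2 * moment (Nat.pred n) i j)).
  + eapply is_RInt2_ext; [|exact H]; intros s t; cbv beta; unfold harmonic.
    (* The product formula shows that multiplication by [u] averages [harmonic] over the four
       neighbouring indices. *)
    pose proof (cos_mul_cos i s) as E1; pose proof (cos_mul_cos j t) as E2.
    replace (cos (IZR (i + 1) * s)) with
      (2 * (cos s * cos (IZR i * s)) - cos (IZR (i - 1) * s)) by lra.
    replace (cos (IZR (j + 1) * t)) with
      (2 * (cos t * cos (IZR j * t)) - cos (IZR (j - 1) * t)) by lra.
    apply (Rmult_INR_succ_inj n); rewrite <- (Rmult_assoc _ (legendre (S n) _)).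
    rewrite legendre_rec; field; lra.
  + apply (Rmult_INR_succ_inj n).
    transitivity (PI ^ 2 * ((INR n + 1) * moment (S n) i j)); [|ring].
    rewrite moment_rec.
    unfold nbr_mean; field; lra.
Qed.

(** * Uniform limits and the power series of [Xi2] *)

Lemma is_RInt_uniform_limit (f : nat -> R -> R) (g : R -> R) (l e : nat -> R) a b :
  a <= b -> (forall n, is_RInt (f n) a b (l n)) ->
  (forall n t, Rabs (f n t - g t) <= e n) -> is_lim_seq e 0 ->
  ex_RInt g a b /\ is_lim_seq l (RInt g a b)
  /\ forall n, Rabs (l n - RInt g a b) <= (b - a) * e n.
Proof.
intros hab hf hfg he.
destruct (filterlim_RInt f a b eventually _ g l hf) as [L [HL1 HL2]].
{ apply filterlim_locally; intros eps.
  apply is_lim_seq_spec in he; destruct (he eps) as [N HN]; exists N; intros n hn t.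
  unfold ball; simpl; unfold AbsRing_ball, abs, minus, plus, opp; simpl.
  specialize (HN n hn); rewrite Rminus_0_r in HN; apply Rabs_lt_between in HN.
  eapply Rle_lt_trans; [|apply HN]; apply hfg. }
rewrite (is_RInt_unique _ _ _ _ HL2).
split; [now exists L|split; [exact HL1|]].
intros n; refine (norm_RInt_le_const (V := R_NormedModule)
  (fun t => f n t - g t) a b (l n - L) (e n) hab _ _).
- intros t _; apply hfg.
- now apply (is_RInt_minus (V := R_NormedModule)).
Qed.

(** The inner integrals converge with error at most [PI * e n], uniformly in [t], so the
    one-variable lemma applies again to the outer integral. *)
Lemma is_RInt2_uniform_limit (f : nat -> R -> R -> R) g (l e : nat -> R) :
  (forall n, is_RInt2 (f n) (l n)) ->
  (forall n s t, Rabs (f n s t - g s t) <= e n) -> is_lim_seq e 0 ->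
  is_lim_seq l (RInt (fun t => RInt (fun s => g s t) 0 PI) 0 PI).
Proof.
intros hf hfg he; pose proof PI_RGT_0 as hpi.
assert (inner : forall t, forall n,
  Rabs (RInt (fun s => f n s t) 0 PI - RInt (fun s => g s t) 0 PI) <= (PI - 0) * e n).
{ intros t.
  apply (is_RInt_uniform_limit (fun n s => f n s t) (fun s => g s t)); trivial; try lra.
  intros n; apply (RInt_correct (V := R_CompleteNormedModule)), (hf n). }
apply (is_RInt_uniform_limit (fun n t => RInt (fun s => f n s t) 0 PI)
  (fun t => RInt (fun s => g s t) 0 PI) l (fun n => (PI - 0) * e n)); try lra.
- intros n; apply (hf n).
- intros n t; apply inner.
- pose proof (is_lim_seq_scal_l e (PI - 0) 0 he) as H; simpl in H.
  now rewrite Rmult_0_r in H.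
Qed.

Lemma Xi2_pseries k1 k2 x : 0 <= x < 1 ->
  is_pseries (fun n => PI ^ 2 / 4 * moment n (Z.of_nat k1) (Z.of_nat k2)) x (Xi2 k1 k2 x).
Proof.
intros hx; apply is_pseries_R.
set (i := Z.of_nat k1); set (j := Z.of_nat k2).
pose (f n s t := sum_n (fun m => legendre m ((cos s + cos t) / 2) * x ^ m) n
                 * harmonic i j s t).
pose (l n := sum_n (fun m => PI ^ 2 * moment m i j * x ^ m) n).
assert (hf : forall n, is_RInt2 (f n) (l n)).
{ assert (term : forall m, is_RInt2
    (fun s t => legendre m ((cos s + cos t) / 2) * x ^ m * harmonic i j s t)
    (PI ^ 2 * moment m i j * x ^ m)).
  { intros m; rewrite (Rmult_comm _ (x ^ m)).
    eapply is_RInt2_ext; [|apply (is_RInt2_scal _ (x ^ m) _ (legendre_moment m i j))].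
    intros s t; cbv beta; ring. }
  intros n; induction n as [|n IH].
  - unfold l; rewrite sum_O; eapply is_RInt2_ext; [|apply (term 0%nat)].
    intros s t; unfold f; now rewrite sum_O.
  - unfold l; rewrite sum_Sn; eapply is_RInt2_ext; [|apply (is_RInt2_plus _ _ _ _ IH (term (S n)))].
    intros s t; unfold f; rewrite sum_Sn; unfold plus; simpl; ring. }
(* The geometric tail bounds the error uniformly in both angles, because [legendre] and [harmonic]
   are bounded by 1. *)
pose (e n := / (1 - x) - sum_n (fun m => x ^ m) n).
assert (hgeom : is_series (fun m => x ^ m) (/ (1 - x))).
{ apply is_series_geom; rewrite Rabs_pos_eq; lra. }
assert (he : is_lim_seq e 0).
{ replace 0 with (/ (1 - x) - / (1 - x)) by ring.
  apply (is_lim_seq_minus' _ _ (/ (1 - x)) (/ (1 - x))); [apply is_lim_seq_const|exact hgeom]. }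
pose proof (is_RInt2_uniform_limit f
  (fun s t => / sqrt (1 + x ^ 2 - 2 * ((cos s + cos t) / 2) * x) * harmonic i j s t)
  l e hf) as H.
assert (lim : is_lim_seq l (4 * Xi2 k1 k2 x)).
{ replace (4 * Xi2 k1 k2 x) with
    (RInt (fun t => RInt (fun s => / sqrt (1 + x ^ 2 - 2 * ((cos s + cos t) / 2) * x)
       * harmonic i j s t) 0 PI) 0 PI).
  - apply H; [|exact he]; clear H.
    intros n s t; unfold f.
    rewrite <- Rmult_minus_distr_r, Rabs_mult.
    assert (hu : Rabs ((cos s + cos t) / 2) <= 1).
    { pose proof (COS_bound s); pose proof (COS_bound t); apply Rabs_le; lra. }
    assert (hh : Rabs (harmonic i j s t) <= 1).
    { unfold harmonic; rewrite Rabs_mult.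
      pose proof (COS_bound (IZR i * s)); pose proof (COS_bound (IZR j * t)).
      assert (Rabs (cos (IZR i * s)) <= 1) by (apply Rabs_le; lra).
      assert (Rabs (cos (IZR j * t)) <= 1) by (apply Rabs_le; lra).
      pose proof (Rabs_pos (cos (IZR i * s))); pose proof (Rabs_pos (cos (IZR j * t))); nra. }
    assert (hs : Rabs (sum_n (fun m => legendre m ((cos s + cos t) / 2) * x ^ m) n
      - / sqrt (1 + x ^ 2 - 2 * ((cos s + cos t) / 2) * x)) <= e n).
    { apply series_tail_bound; trivial.
      - intros m; rewrite Rabs_mult, (Rabs_pos_eq (x ^ m)) by (apply pow_le; lra).
        pose proof (legendre_bound m _ hu); pose proof (pow_le x m (proj1 hx)); nra.
      - now apply legendre_generating. }
    match goal with |- ?A * ?B <= _ => pose proof (Rabs_pos (harmonic i j s t));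
      assert (0 <= A) by apply Rabs_pos end.
    nra.
  - unfold Xi2; rewrite <- Rmult_assoc, Rinv_r, Rmult_1_l by lra.
    apply RInt_ext; intros t _; apply RInt_ext; intros s _.
    unfold harmonic, i, j; rewrite <- !INR_IZR_INZ.
    replace (1 + x ^ 2 - 2 * ((cos s + cos t) / 2) * x)
      with (1 + x ^ 2 - x * (cos s + cos t)) by field.
    apply Rmult_comm. }
assert (S : is_series (fun m => PI ^ 2 * moment m i j * x ^ m) (4 * Xi2 k1 k2 x)) by exact lim.
apply (is_series_scal (/ 4)) in S.
change (scal (/ 4) (4 * Xi2 k1 k2 x)) with (/ 4 * (4 * Xi2 k1 k2 x)) in S.
replace (/ 4 * (4 * Xi2 k1 k2 x)) with (Xi2 k1 k2 x) in S by field.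
eapply is_series_ext; [|exact S]; intros n.
change (/ 4 * (PI ^ 2 * moment n i j * x ^ n) = PI ^ 2 / 4 * moment n i j * x ^ n).
field.
Qed.

(** * Termwise differentiation and the differential equation *)

(** The derivative is again given by a power series, so the lemma can be iterated. *)
Lemma is_deriv_Ico_PSeries f a :
  (forall x, 0 <= x < 1 -> is_pseries a x (f x)) ->
  exists g, (forall x, 0 <= x < 1 -> is_pseries (PS_derive a) x (g x))
            /\ is_deriv_Ico f g.
Proof.
intros H; exists (PSeries (PS_derive a)).
assert (hr : forall x, 0 <= x < 1 -> Rbar_lt (Rabs x) (CV_radius a)).
{ apply CV_radius_ge_1; intros x hx; exists (f x); now apply H. }
split.
- intros x hx; apply PSeries_correct, CV_radius_inside.
  rewrite CV_radius_derive; now apply hr.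
- intros x hx.
  assert (D : D_in (PSeries a) (PSeries (PS_derive a)) unit_Ico x).
  { assert (D : D_in (PSeries a) (PSeries (PS_derive a)) no_cond x).
    { now apply derivable_pt_lim_D_in, is_derive_Reals, is_derive_PSeries, hr. }
    intros eps heps; destruct (D eps heps) as [alp [halp D']]; exists alp; split; trivial.
    intros y [[_ hy] hd]; apply D'; repeat split; trivial. }
  (* [f] is known to agree with the series only on [[0, 1)], which contains both points of the
     difference quotient. *)
  intros eps heps; destruct (D eps heps) as [alp [halp D']]; exists alp; split; trivial.
  intros y hy; specialize (D' y hy); destruct hy as [[hy _] _].
  now rewrite (is_pseries_unique _ _ _ (H x hx)), (is_pseries_unique _ _ _ (H y hy)) in D'.
Qed.

(** [x^j D^j] multiplies the coefficient of [x^n] by the falling factorial [n (n-1) ... (n-j+1)]. *)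
Lemma is_pseries_euler (a : nat -> R) (f f1 f2 f3 x : R) :
  is_pseries a x f -> is_pseries (PS_derive a) x f1 ->
  is_pseries (PS_derive (PS_derive a)) x f2 ->
  is_pseries (PS_derive (PS_derive (PS_derive a))) x f3 ->
  forall p q r s,
  is_pseries (fun n => (p * (INR n * (INR n - 1) * (INR n - 2))
                        + q * (INR n * (INR n - 1)) + r * INR n + s) * a n) x
    (p * (x ^ 3 * f3) + q * (x ^ 2 * f2) + r * (x * f1) + s * f).
Proof.
intros H0 H1 H2 H3 p q r s.
apply is_pseries_mul_x in H1.
apply is_pseries_mul_x, is_pseries_mul_x in H2.
apply is_pseries_mul_x, is_pseries_mul_x, is_pseries_mul_x in H3.
pose proof (is_pseries_add _ _ _ _ _
  (is_pseries_add _ _ _ _ _ (is_pseries_mul_const _ p _ _ H3)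
     (is_pseries_mul_const _ q _ _ H2))
  (is_pseries_add _ _ _ _ _ (is_pseries_mul_const _ r _ _ H1)
     (is_pseries_mul_const _ s _ _ H0))) as H.
replace (_ + _ + _ + _) with (p * (x * (x * (x * f3))) + q * (x * (x * f2))
  + (r * (x * f1) + s * f)) by ring.
eapply is_pseries_ext; [|exact H]; intros n.
match goal with |- ?l = ?r => change (@eq R l r) end.
unfold PS_incr_1, PS_derive; change zero with 0.
destruct n as [|[|[|n]]]; cbv beta iota; rewrite ?S_INR; simpl INR; ring.
Qed.

(** The operator is a degree-preserving part, with primed coefficients, plus [x^2] times another
    such part. Hence [a (n+2)] is paired with [a n], and [a 0], [a 1] must each satisfy a condition
    alone. *)
Lemma pseries_third_order_ode (a : nat -> R) (f f1 f2 f3 x p q r p' q' r' : R) :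
  is_pseries a x f -> is_pseries (PS_derive a) x f1 ->
  is_pseries (PS_derive (PS_derive a)) x f2 ->
  is_pseries (PS_derive (PS_derive (PS_derive a))) x f3 ->
  r' * a 0%nat = 0 -> (q' + r') * a 1%nat = 0 ->
  (forall n,
    ((INR n + 2) * (INR n + 1) * INR n + p' * ((INR n + 2) * (INR n + 1))
       + q' * (INR n + 2) + r') * a (S (S n))
    + (INR n * (INR n - 1) * (INR n - 2) + p * (INR n * (INR n - 1))
       + q * INR n + r) * a n = 0) ->
  x ^ 3 * (1 + x ^ 2) * f3 + x ^ 2 * (p * x ^ 2 + p') * f2
  + x * (q * x ^ 2 + q') * f1 + (r * x ^ 2 + r') * f = 0.
Proof.
intros H0 H1 H2 H3 h0 h1 hn.
pose proof (is_pseries_euler a f f1 f2 f3 x H0 H1 H2 H3) as E.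
pose proof (is_pseries_add _ _ _ _ _ (E 1 p' q' r')
  (is_pseries_mul_x _ _ _ (is_pseries_mul_x _ _ _ (E 1 p q r)))) as H.
apply is_pseries_zero in H; [lra|].
intros n; unfold PS_incr_1; change zero with 0.
destruct n as [|[|n]]; cbv beta iota; [simpl INR; lra|simpl INR; lra|].
rewrite !S_INR, <- (hn n); ring.
Qed.

Theorem corollary5 (k1 k2 : nat) (hk : (k1 <= k2)%nat) (hd : (k2 - k1 <= 1)%nat) :
  exists f1 f2 f3 : R -> R,
    is_deriv_Ico (Xi2 k1 k2) f1 /\
    is_deriv_Ico f1 f2 /\
    is_deriv_Ico f2 f3 /\
    forall x : R, 0 <= x < 1 ->
      x ^ 3 * (1 + x ^ 2) * f3 x
      + x ^ 2 * ((INR k1 - INR k2 + 6) * (x ^ 2 - 1) + 9) * f2 x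
      - x * ((INR k1 + INR k2) ^ 2 * (x ^ 2 + 1)
             + (INR k2 - INR k1 - 7 / 3) * (3 * x ^ 2 - 1) - 10 / 3) * f1 x
      + (x ^ 2 * ((INR k1 + INR k2) ^ 2 - 1) * (INR k2 - INR k1 - 1)
         + (INR k1 - INR k2) * (INR k1 + INR k2) ^ 2) * Xi2 k1 k2 x
      = 0.
Proof.
destruct (is_deriv_Ico_PSeries _ _ (Xi2_pseries k1 k2)) as [f1 [H1 D1]].
destruct (is_deriv_Ico_PSeries _ _ H1) as [f2 [H2 D2]].
destruct (is_deriv_Ico_PSeries _ _ H2) as [f3 [H3 D3]].
exists f1, f2, f3; repeat split; trivial; intros x hx.
set (s := INR k1 + INR k2); set (d := INR k2 - INR k1).
(* The unprimed parameters collect the terms carrying the extra factor [x^2] in the equation, the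
   primed ones the rest. *)
pose proof (pseries_third_order_ode _ (Xi2 k1 k2 x) (f1 x) (f2 x) (f3 x) x
  (6 - d) (- (s ^ 2 + 3 * (d - 7 / 3))) ((s ^ 2 - 1) * (d - 1))
  (3 + d) (- (s ^ 2 - (d - 7 / 3) - 10 / 3)) (- d * s ^ 2)
  (Xi2_pseries k1 k2 x hx) (H1 x hx) (H2 x hx) (H3 x hx)) as ode.
match type of ode with ?A -> ?B -> ?C -> _ => assert (hc : A /\ B /\ C) end;
  [|destruct hc as [h0 [h1 hn]]; specialize (ode h0 h1 hn);
    unfold d in *; rewrite <- ode; field].
clear ode; unfold s, d; rewrite (INR_IZR_INZ k1).
(* The cases are [d = 0], [s = 2k] on the diagonal and [d = 1], [s = 2k + 1] next to it. *)
assert (E : k2 = k1 \/ k2 = S k1) by lia; destruct E as [-> | ->].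
- rewrite INR_IZR_INZ; set (k := Z.of_nat k1).
  split; [|split].
  + lra.
  + rewrite moment_1_diag; lra.
  + intros n; pose proof (moment_diag_step n k) as H.
    apply (f_equal (Rmult (PI ^ 2 / 4))) in H; lra.
- rewrite S_INR, INR_IZR_INZ.
  replace (Z.of_nat (S k1)) with (Z.of_nat k1 + 1)%Z by lia; set (k := Z.of_nat k1).
  split; [|split].
  + rewrite moment_0_near_diag; lra.
  + pose proof (moment_1_near_diag k) as H.
    (* For [d = 1] the condition on [a 1] has the factor [2 (1 - s^2)], hence [PI ^ 2 / 2] in place
       of [PI ^ 2 / 4]. *)
    apply (f_equal (Rmult (PI ^ 2 / 2))) in H; lra.
  + intros n; pose proof (moment_near_diag_step n k) as H.
    apply (f_equal (Rmult (PI ^ 2 / 4))) in H; lra.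
Qed.
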